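(* Let $k\geq 2$, let $\mathbb F_q$ be the finite field with $q$ elements, let $\beta\in\mathbb Z_{\geq 0}^k$, and let $V_1,\ldots,V_k$ be vector spaces over $\mathbb F_q$ with $\dim V_i=\beta_i$. The number $N(\beta)=|\mathcal N(\beta)|$ of nilpotent representations of the cyclic quiver with dimension vector $\beta$ is $$N(\beta)=q^{\sum_{i=1}^k\beta_i\beta_{i+1}-\sum_{i=1}^k\beta_i}\left(q^{\sum_{i=1}^k\beta_i}-\prod_{i=1}^k(q^{\beta_i}-1)\right).$$
   Context: Indices are taken modulo $k$ (so $\beta_{k+1}=\beta_1$, $V_{k+1}=V_1$). $Q$ is the cyclic quiver $1\to 2\to\cdots\to k\to 1$ and $\mathrm{Rep}(Q,\beta)=\prod_{i=1}^k\mathrm{Hom}_{\mathbb F_q}(V_i,V_{i+1})$. A representation $f=(f_1,\ldots,f_k)\in\mathrm{Rep}(Q,\beta)$ is nilpotent if for each $1\leq i\leq k$ and all sufficiently large $\ell$ the composition $f_{i+\ell-1}\circ\cdots\circ f_i$ is zero. $\mathcal N(\beta)\subseteq\mathrm{Rep}(Q,\beta)$ is the subset of nilpotent representations. The exponent of $q$ may be negative; the identity holds in the rational numbers. *)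

(* Defs.v *)
From HB Require Import structures.
From mathcomp Require Import all_boot all_order all_algebra all_field.
From mathcomp Require Import boolp.

Set Implicit Arguments.
Unset Strict Implicit.
Unset Printing Implicit Defensive.
Import GRing.Theory.

Local Open Scope ring_scope.

(* The vertices 1, ..., k of the cyclic quiver are the elements of 'I_k, and
   the arrow out of i goes to ordS i, the cyclic successor of i modulo k. *)
Section CyclicQuiver.

Variables (F : finFieldType) (k : nat) (V : 'I_k -> vectType F).

(* finvect_type only makes the finType structure on the set of linear maps
   visible; its carrier is 'Hom(V i, V (ordS i)) itself. *)
Definition cyclic_rep : finType :=
  {dffun forall i : 'I_k, finvect_type 'Hom(V i, V (ordS i))}.

Definition rep_map (f : cyclic_rep) (i : 'I_k) : 'Hom(V i, V (ordS i)) := f i.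

(* f_(i + l - 1) \o ... \o f_i, with values in V_(i + l) *)
Fixpoint rep_comp (f : cyclic_rep) (i : 'I_k) (l : nat) :
    'Hom(V i, V (iter l (@ordS k) i)) :=
  if l is l'.+1
  then (rep_map f (iter l' (@ordS k) i) \o rep_comp f i l')%VF
  else \1%VF.

Definition nilpotent_rep (f : cyclic_rep) : Prop :=
  forall i : 'I_k, exists L : nat,
    forall l : nat, (L <= l)%N -> rep_comp f i l = 0.

Definition nilpotent_reps : {set cyclic_rep} :=
  [set f | `[< nilpotent_rep f >]].

End CyclicQuiver.

(* Main.v *)
(* A nonnilpotent representation has, on average, exactly one invariant section
   (v_1, ..., v_k) with v_i <> 0 and f_i v_i = v_(i+1). Indeed such sections are
   the nonzero fixed vectors of the monodromy M = f_k \o ... \o f_1 on V_1, and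
   they lie in the stable image I of M, the largest subspace on which M is
   bijective, which is nonzero iff f is not nilpotent. For nonzero x and w in I
   pick an automorphism h of V_1 with h x = w and h = 1 modulo I. Replacing f_k
   by h \o f_k turns M into h \o M without changing I, so among the f with
   stable image I as many satisfy M x = x as satisfy M x = w; summing over x,
   the latter count every such f once, since w has one preimage in I.
   Hence the nonnilpotent representations are as many as the pairs (f, v), which
   are counted by choosing v first: there are prod_i (q^(b_i) - 1) choices, each
   preserved by a proportion q^(- sum_i b_i) of all representations. *)
Require Import Defs.
From HB Require Import structures.
From mathcomp Require Import all_boot all_order all_algebra all_field.
From mathcomp Require Import boolp zify.

Set Implicit Arguments.
Unset Strict Implicit.
Unset Printing Implicit Defensive.
Import GRing.Theory.

Local Open Scope ring_scope.

(** * Eventual periodicity of self-maps of a finite set *)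

Lemma iter_card_fact_idem (T : finType) (f : T -> T) (x : T) :
  iter #|T|`! f (iter #|T|`! f x) = iter #|T|`! f x.
Proof.
set N := #|T|`!.
have /trajectP[i lt_io eq_io] := looping_order f x.
have ordN : (order f x <= #|T|)%N by exact: max_card.
(* From index [i] on, the orbit has period [p]. Both are at most [#|T|], so [p] divides [N] and
   [i <= N]: after [N] steps, [N] more change nothing. *)
pose p := (order f x - i)%N.
have periodic m : (i <= m)%N -> iter (m + p) f x = iter m f x.
  move=> le_im; rewrite -(subnK le_im) -addnA subnKC 1?ltnW //.
  by rewrite !iterD eq_io.
have periodicM m j : (i <= m)%N -> iter (m + j * p) f x = iter m f x.
  move=> le_im; elim: j => [|j IH]; first by rewrite addn0.
  rewrite mulSn [(p + _)%N]addnC addnA periodic ?IH //.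
  by rewrite (leq_trans le_im) ?leq_addr.
have p_dvd : (p %| N)%N.
  by apply: dvdn_fact; rewrite subn_gt0 lt_io (leq_trans (leq_subr _ _)).
rewrite -iterD -{1}(divnK p_dvd) addnC periodicM //.
apply: leq_trans (ltnW lt_io) (leq_trans ordN _).
rewrite /N; case: #|T| => // m.
by rewrite dvdn_leq ?fact_gt0 ?dvdn_fact ?ltnS ?leqnn.
Qed.

(** * Rank-one maps, linear forms and transvections *)

Section RankOne.

Variables (F : fieldType) (A B : vectType F).

Definition rank_one_fun (phi : 'Hom(A, F^o)) (b : B) (x : A) : B := phi x *: b.

Fact rank_one_linear phi b : linear (rank_one_fun phi b).
Proof.
by move=> c x y; rewrite /rank_one_fun linearP scalerDl scalerA.
Qed.

HB.instance Definition _ phi b :=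
  GRing.isLinear.Build F A B _ (rank_one_fun phi b) (rank_one_linear phi b).

Definition rank_one phi b : 'Hom(A, B) := linfun (rank_one_fun phi b).

Lemma rank_oneE phi b x : rank_one phi b x = phi x *: b.
Proof. by rewrite lfunE. Qed.

End RankOne.

Section LinearForms.

Variables (F : fieldType) (A : vectType F).

Lemma form_neq0 (x : A) : x != 0 -> exists phi : 'Hom(A, F^o), phi x != 0.
Proof.
move=> x0; apply: contrapT => no_phi; case/eqP: x0.
rewrite (coord_vbasis (memvf x)) big1 // => i _.
have [->|ci] := eqVneq (coord (vbasis {:A}) i x) 0; first by rewrite scale0r.
case: no_phi; exists (linfun (coord (vbasis {:A}) i : A -> F^o)).
by rewrite lfunE.
Qed.

Lemma form_neq0_pair (x y : A) : x != 0 -> y != 0 ->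
  exists phi : 'Hom(A, F^o), phi x != 0 /\ phi y != 0.
Proof.
move=> /form_neq0[f fx] /form_neq0[g gy].
have [fy|] := eqVneq (f y) 0; last by exists f.
have [gx|] := eqVneq (g x) 0; last by exists g.
by exists (f + g); rewrite !add_lfunE fy gx add0r addr0.
Qed.

(** A rank-one perturbation of the identity, built from a form [f] that vanishes at neither vector:
    [f x != 0] lets it send [x] to [y], and [f y != 0] makes it injective. *)
Lemma exists_move (x y : A) : x != 0 -> y != 0 ->
  exists h : 'End(A), [/\ injective h, h x = y &
    forall z, exists c, h z - z = c *: (y - x)].
Proof.
move=> x0 y0; have [f [fx fy]] := form_neq0_pair x0 y0.
pose h : 'End(A) := \1%VF + rank_one f ((f x)^-1 *: (y - x)).
have hE z : h z = z + (f z / f x) *: (y - x).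
  by rewrite add_lfunE id_lfunE rank_oneE scalerA.
exists h; split; last by move=> z; exists (f z / f x); rewrite hE addrC addKr.
  move=> a b; rewrite !hE => eq_ab.
  (* Applying [f] turns the equation into [f z * f y / f x = 0], so [f z = 0] and the perturbation
     vanishes at [z]. *)
  have d0 z : z + (f z / f x) *: (y - x) = 0 -> z = 0.
    move=> hz; have := congr1 f hz.
    rewrite linearD linearZ linearB linear0 /= => fz.
    have : f z * f y = 0.
      apply: (mulfI (invr_neq0 fx)); rewrite mulr0 -fz /GRing.scale /= mulrBr.
      rewrite -[_ / _ * f x]mulrA mulVf // mulr1 addrC subrK.
      by rewrite mulrA [_^-1 * _]mulrC.
    move/eqP; rewrite mulf_eq0 (negPf fy) orbF => /eqP fz0.
    by move: hz; rewrite fz0 mul0r scale0r addr0.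
  apply/eqP; rewrite -subr_eq0; apply/eqP/d0.
  rewrite (linearB f) /= mulrBl scalerBl addrACA eq_ab -opprD.
  by apply/eqP; rewrite subr_eq0.
by rewrite hE divff // scale1r addrC subrK.
Qed.

End LinearForms.

(** * Counting linear maps over a finite field *)

Section CardHom.

Variable F : finFieldType.

Lemma card_finvect (A : vectType F) : #|finvect_type A| = (#|F| ^ \dim {:A})%N.
Proof. rewrite -(@card_vspacef F (finvect_type A) (Vector.class A)).
exact: card_vspace. Qed.

Lemma dim_Hom (A B : vectType F) :
  \dim {:'Hom(A, B)} = (\dim {:A} * \dim {:B})%N.
Proof. by rewrite !dimvf. Qed.

(** Translation by a rank-one map carries any fibre of evaluation at [a] into any other, so all
    [#|F| ^ \dim {:B}] fibres have the same size. *)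
Lemma card_Hom_at (A B : vectType F) (a : A) (b : B) : a != 0 ->
  (#|[set g : finvect_type 'Hom(A, B) | (g : 'Hom(A, B)) a == b]|
     * #|F| ^ \dim {:B} = #|F| ^ (\dim {:A} * \dim {:B}))%N.
Proof.
move=> a0; pose E (c : finvect_type B) :=
  [set g : finvect_type 'Hom(A, B) | (g : 'Hom(A, B)) a == c].
have leE c d : (#|E c| <= #|E d|)%N.
  have [f fa] := form_neq0 a0.
  pose t (g : finvect_type 'Hom(A, B)) : finvect_type 'Hom(A, B) :=
    (g : 'Hom(A, B)) + rank_one f ((f a)^-1 *: (d - c)).
  have t_inj : injective t by move=> g g' /addIr.
  rewrite -(card_imset _ t_inj); apply/subset_leq_card/subsetP.
  move=> _ /imsetP[g + ->]; rewrite !inE => /eqP ga.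
  by rewrite add_lfunE ga rank_oneE scalerA divff // scale1r addrC subrK.
rewrite -dim_Hom -(card_finvect 'Hom(A, B)) -(card_finvect B).
have -> : #|finvect_type 'Hom(A, B)| = (\sum_(c : finvect_type B) #|E c|)%N.
  rewrite -sum1_card (partition_big
    (fun g => (g : 'Hom(A, B)) a : finvect_type B) predT) //=.
  by apply: eq_bigr => c _; rewrite -sum1_card; apply: eq_bigl => g; rewrite inE.
rewrite (eq_bigr (fun=> #|E b|)).
  by rewrite sum_nat_const mulnC.
by move=> c _; apply/eqP; rewrite eqn_leq !leE.
Qed.

End CardHom.

(** * The stable image of an endomorphism *)

Section StableImage.

Variables (F : finFieldType) (U : vectType F).

Local Notation fU := (finvect_type U).
Local Notation N := (#|fU|`!).

(* The [N]-th iterate of any self-map of [U] is idempotent, so its fixed points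
   are the recurrent vectors of [T], which form its eventual image. *)
Definition stable (T : 'End(U)) : {set fU} := [set x : fU | iter N T x == x].

Implicit Types S T h : 'End(U).

Lemma stableP T (x : fU) : reflect (iter N T x = x) (x \in stable T).
Proof. by rewrite inE; apply: eqP. Qed.

Lemma iterB T m (x y : U) : iter m T (x - y) = iter m T x - iter m T y.
Proof. by elim: m => //= m ->; rewrite linearB. Qed.

Lemma iterZ T m c (x : U) : iter m T (c *: x) = c *: iter m T x.
Proof. by elim: m => //= m ->; rewrite linearZ. Qed.

Lemma stable_iter T (x : U) : iter N T x \in stable T.
Proof. by apply/stableP; apply: (@iter_card_fact_idem fU). Qed.

Lemma stable_periodic T m (x : U) :
  (0 < m)%N -> iter m T x = x -> x \in stable T.
Proof.
move=> m0 Tx; have iterM j : iter (j * m)%N T x = x.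
  by elim: j => // j IH; rewrite mulSn iterD IH.
(* With the [N] iterations of [stable_iter] this makes [m * N] steps, a multiple of the period [m],
   so the vector reached is [x] itself. *)
have := stable_iter T (iter (m.-1 * N)%N T x).
by rewrite -iterD -mulSn prednK // mulnC iterM.
Qed.

Lemma stable_fun T (x : U) : x \in stable T -> T x \in stable T.
Proof. by move/stableP=> Tx; apply/stableP; rewrite -iterSr iterS Tx. Qed.

Lemma stableB T (x y : U) :
  x \in stable T -> y \in stable T -> x - y \in stable T.
Proof.
by move=> /stableP Tx /stableP Ty; apply/stableP; rewrite iterB Tx Ty.
Qed.

Lemma stableZ T c (x : U) : x \in stable T -> c *: x \in stable T.
Proof. by move=> /stableP Tx; apply/stableP; rewrite iterZ Tx. Qed.

Lemma stable0 T : (0 : U) \in stable T.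
Proof. by apply/stableP; elim: N => //= m ->; rewrite linear0. Qed.

Lemma stableD T (x y : U) :
  x \in stable T -> y \in stable T -> x + y \in stable T.
Proof.
by move=> Ix Iy; rewrite -[y]opprK -[- y]add0r !stableB // stable0.
Qed.

(** [T] permutes its stable image, with inverse the [N.-1]-th iterate. *)
Lemma stable_preim T (w : U) : w \in stable T ->
  exists2 x, x \in stable T & forall y, y \in stable T -> (T y == w) = (y == x).
Proof.
move=> Iw; exists (iter N.-1 T w).
  by elim: N.-1 => //= m; apply: stable_fun.
have NE : N = N.-1.+1 by rewrite prednK ?fact_gt0.
move=> y /stableP Ty; apply/eqP/eqP=> [<-|->].
  by rewrite -iterSr -NE.
by move/stableP: Iw; rewrite {1}NE.
Qed.

(* Modulo [stable T] the maps [S] and [T] agree and are nilpotent; on [stable T]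
   both are injective. *)
Lemma stable_comp (S T h : 'End(U)) : injective h ->
    (forall x, S x = h (T x)) ->
    (forall x, h x - x \in stable T) -> stable S = stable T.
Proof.
move=> h_inj SE h_mod.
have S_mod m x : iter m S x - iter m T x \in stable T.
  elim: m => [|m IH] /=; first by rewrite subrr stable0.
  rewrite SE -(subrK (T (iter m S x)) (h _)) -addrA -linearB.
  by rewrite stableD ?h_mod ?stable_fun.
have subIS x : x \in stable S -> x \in stable T.
  move=> /stableP {1}<-; rewrite -(subrK (iter N T x) (iter N S x)).
  by rewrite stableD // stable_iter.
have S_stable m x : x \in stable T -> iter m S x \in stable T.
  move=> Ix; elim: m => //= m IH; rewrite SE -(subrK (T (iter m S x)) (h _)).
  by rewrite stableD ?h_mod ?stable_fun.
have S_inj m x : x \in stable T -> iter m S x = 0 -> x = 0.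
  elim: m => //= m IH Ix Sx; apply: IH => //.
  have [z _ zP] := stable_preim (stable0 T).
  have Tx : T (iter m S x) = 0 by apply: h_inj; rewrite -SE Sx linear0.
  have T0 : T 0 == 0 by rewrite linear0.
  move/eqP: Tx; rewrite zP ?S_stable // => /eqP ->.
  by apply/eqP; rewrite eq_sym -zP ?stable0.
apply/setP=> x; apply/idP/idP; first exact: subIS.
move=> Ix; have Iy := stable_iter S x.
(* This difference lies in [stable T] and is killed by the idempotent [iter N S], which is injective
   there. *)
suff /eqP : x - iter N S x = 0 by rewrite subr_eq0 => /eqP ->.
apply: (S_inj N); first by rewrite stableB // subIS.
by rewrite iterB; move/stableP: Iy => ->; rewrite subrr.
Qed.

(** Abstracts the averaging argument: [D] will be the set of representations, [M] the monodromy, and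
    [t h] composition of the arrow into the base vertex with [h]. *)
Variables (D : finType) (M : D -> 'End(U)) (t : 'End(U) -> D -> D).
Hypothesis tM : forall h f x, M (t h f) x = h (M f x).
Hypothesis t_inj : forall h, injective h -> injective (t h).

Lemma card_stable_fiber (I : {set fU}) (x y w : fU) :
    y \in I -> w \in I -> y != 0 -> w != 0 ->
  #|[set f : D | (stable (M f) == I) && (M f x == y)]|
    = #|[set f : D | (stable (M f) == I) && (M f x == w)]|.
Proof.
pose E z := [set f : D | (stable (M f) == I) && (M f x == z)].
suff leE a b : a \in I -> b \in I -> a != 0 -> b != 0 -> (#|E a| <= #|E b|)%N.
  by move=> *; apply/eqP; rewrite eqn_leq !leE.
move=> Ia Ib a0 b0; have [h [h_inj ha h_mod]] := exists_move a0 b0.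
rewrite -(card_imset _ (t_inj h_inj)); apply/subset_leq_card/subsetP.
move=> _ /imsetP[f + ->]; rewrite !inE => /andP[/eqP fI /eqP fx].
rewrite tM fx ha eqxx andbT -fI; apply/eqP/(stable_comp h_inj (tM h f)) => z.
have [c ->] := h_mod z; apply: stableZ; apply: stableB; by rewrite fI.
Qed.

Lemma card_stable_neq0 :
  (#|[set f : D | [exists x in stable (M f), x != 0%R]]|
    = \sum_(f : D) #|[set x : fU | (x != 0%R) && (M f x == x)]|)%N.
Proof.
rewrite -sum1_card (partition_big (stable \o M) predT) //=.
rewrite [RHS](partition_big (stable \o M) predT) //=.
apply: eq_bigr => I _.
have [/existsP[w /andP[Iw w0]]|] := boolP [exists x in I, x != 0].
  transitivity (\sum_(x in I | x != 0%R)
      #|[set f : D | (stable (M f) == I) && (M f x == x)]|)%N; last first.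
    under eq_bigr => x _ do rewrite -sum1_card.
    rewrite (exchange_big_dep (fun f => stable (M f) == I)) /=; last first.
      by move=> x f _; rewrite inE => /andP[].
    apply: eq_bigr => f /eqP fI; rewrite -sum1_card; apply: eq_bigl => x.
    rewrite !inE fI eqxx /=.
    case: (M f x =P x) => [Mx|_]; rewrite ?andbF // !andbT.
    by rewrite -fI (@stable_periodic _ 1).
  (* The target [x], which varies with the summand, is replaced by one fixed [w]; then each [f] is
     counted once, by the preimage of [w] in [I]. *)
  rewrite (eq_bigr (fun x =>
      #|[set f : D | (stable (M f) == I) && (M f x == w)]|));
    last by move=> x /andP[Ix x0]; apply: card_stable_fiber.
  under [RHS]eq_bigr => x _ do rewrite -sum1_card.
  rewrite (exchange_big_dep (fun f => stable (M f) == I)) /=; last first.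
    by move=> x f _; rewrite inE => /andP[].
  apply: eq_big => [f|f]; rewrite inE.
    by apply: andb_idl => /eqP ->; apply/existsP; exists w; rewrite Iw.
  move=> /andP[_ /eqP fI]; move: Iw; rewrite -fI => Iw.
  have [x Ix xP] := stable_preim Iw.
  rewrite (big_pred1 x) // => y; rewrite [f \in _]inE fI eqxx /= -fI.
  have [->|yx] := eqVneq y x.
    rewrite Ix xP // eqxx andbT; apply: contraNN w0 => /eqP x0.
    by rewrite -(eqP (etrans (xP x Ix) (eqxx x))) x0 linear0.
  have [Iy|] := boolP (y \in stable _); last by [].
  by rewrite xP // (negPf yx) andbF.
move=> noI; rewrite big_pred0 => [|f]; last first.
  by rewrite inE; apply/negP => /andP[+ /eqP fI]; rewrite fI (negPf noI).
rewrite big1 // => f /eqP fI; apply/eqP; rewrite cards_eq0; apply/eqP/setP=> x.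
rewrite !inE; apply/negP => /andP[x0 /eqP Mx]; case/negP: noI.
by apply/existsP; exists x; rewrite x0 -fI (@stable_periodic _ 1).
Qed.

End StableImage.

(** * Monodromy around the cycle and its twists *)

Lemma val_iter_ordS k l (i : 'I_k) :
  iter l (@ordS k) i = ((i + l) %% k)%N :> nat.
Proof.
elim: l => [|l IH] /=; first by rewrite addn0 modn_small.
by rewrite IH -addn1 modnDml addn1 addnS.
Qed.

Section Monodromy.

Variables (F : finFieldType) (n : nat) (V : 'I_n.+1 -> vectType F).

Local Notation rep := (cyclic_rep V).
Implicit Types (f : rep) (i j : 'I_n.+1) (u : {i & V i}) (h : 'End(V ord0)).

(* All the maps of a representation, bundled into one self-map of the disjoint
   union of the V i: its iterates compose without any transport between the
   types V (iter l ordS i). *)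
Definition step f u : {i & V i} := Tagged V (rep_map f (tag u) (tagged u)).

Lemma iter_step f l i (x : V i) :
  iter l (step f) (Tagged V x) = Tagged V (rep_comp f i l x).
Proof.
elim: l => [|l IH] /=; first by rewrite id_lfunE.
by rewrite IH /step /= comp_lfunE.
Qed.

Lemma tag_iter_step f l u : tag (iter l (step f) u) = iter l (@ordS _) (tag u).
Proof. by elim: l => //= l ->. Qed.

Definition is_zero u := tagged u == 0.

Lemma iter_step0 f l u : is_zero u -> is_zero (iter l (step f) u).
Proof.
by move=> u0; elim: l => //= l /eqP; rewrite /is_zero /= => ->; rewrite linear0.
Qed.

Lemma iter_ordS_n : iter n.+1 (@ordS n.+1) ord0 = ord0.
Proof. by apply: ord_inj; rewrite val_iter_ordS add0n modnn. Qed.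

(** A full turn ends in [V (iter n.+1 ordS ord0)], which is [V ord0] only up to a proved equality,
    hence the transport. *)
Definition monodromy f : 'End(V ord0) :=
  eq_rect _ (fun i => 'Hom(V ord0, V i)) (rep_comp f ord0 n.+1) _ iter_ordS_n.

Lemma Tagged_eq_rect i j (e : i = j) (A : vectType F) (g : 'Hom(A, V i)) x :
  Tagged V (eq_rect i (fun j => 'Hom(A, V j)) g j e x) = Tagged V (g x).
Proof. by case: _ / e. Qed.

Lemma monodromyE f (x : V ord0) :
  Tagged V (monodromy f x) = iter n.+1 (step f) (Tagged V x).
Proof. by rewrite iter_step Tagged_eq_rect. Qed.

Lemma iter_monodromyE f m (x : V ord0) :
  Tagged V (iter m (monodromy f) x) = iter (m * n.+1)%N (step f) (Tagged V x).
Proof. by elim: m => // m IH; rewrite iterS monodromyE IH -iterD. Qed.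

Lemma nilpotent_stable f : nilpotent_rep f <->
  ~~ [exists x in stable (monodromy f), x != 0].
Proof.
set N := #|finvect_type (V ord0)|`!.
split=> [nil_f|nz].
  apply/existsP=> -[x /andP[/stableP Ix /eqP]]; case.
  have [L nilL] := nil_f ord0.
  have iterM m : iter (m * N)%N (monodromy f) x = x.
    by elim: m => // m IH; rewrite mulSn iterD IH.
  (* [L * N] turns fix the stable vector [x], yet they make at least [L] steps and so kill it. *)
  have leL : (L <= L * N * n.+1)%N.
    by rewrite -mulnA leq_pmulr // muln_gt0 fact_gt0.
  apply/eqP; rewrite -[_ == 0]/(is_zero (Tagged V x)) -(iterM L).
  by rewrite iter_monodromyE iter_step /is_zero /= nilL // zero_lfunE.
have nilN (y : V ord0) : iter N (monodromy f) y = 0.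
  apply/eqP; apply: contraNT nz => y0; apply/existsP.
  by exists (iter N (monodromy f) y); rewrite y0 stable_iter.
(* At most [n.+1] steps lead from [i] to [ord0], then [N] full turns give zero, and the remaining
   steps preserve zero. *)
move=> i; exists (n.+1 + N * n.+1)%N => l le_l; apply/lfunP=> x.
apply/eqP; rewrite zero_lfunE -[_ == 0]/(is_zero (Tagged V _)) -iter_step.
have lt_i := ltn_ord i.
have -> : l = (l - (n.+1 - i) - N * n.+1 + (N * n.+1 + (n.+1 - i)))%N by lia.
rewrite !iterD; apply: iter_step0.
set u := iter (n.+1 - i)%N _ _.
have tu : tag u = ord0.
  rewrite tag_iter_step; apply: ord_inj.
  by rewrite val_iter_ordS subnKC ?modnn // ltnW.
by rewrite -(etaggedK tu) -iter_monodromyE nilN /is_zero.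
Qed.

Definition at_ord0 h j : 'End(V j) :=
  if ord0 =P j is ReflectT e
  then eq_rect _ (fun j => 'End(V j)) h j e else \1%VF.

Lemma at_ord00 h : at_ord0 h ord0 = h.
Proof. by rewrite /at_ord0; case: eqP => // e; rewrite eq_axiomK. Qed.

Lemma at_ord0_id h j : j != ord0 -> at_ord0 h j = \1%VF.
Proof. by rewrite /at_ord0; case: eqP => // e /eqP[]. Qed.

Lemma at_ord0_inj h j : injective h -> injective (at_ord0 h j).
Proof.
rewrite /at_ord0; case: eqP => [e|_ _ x y]; last by rewrite !id_lfunE.
by case: _ / e.
Qed.

Definition twist h f : rep :=
  [ffun i => (at_ord0 h (ordS i) \o rep_map f i)%VF].

Lemma twistE h f i x :
  rep_map (twist h f) i x = at_ord0 h (ordS i) (rep_map f i x).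
Proof. by rewrite /rep_map ffunE comp_lfunE. Qed.

Lemma twist_inj h : injective h -> injective (twist h).
Proof.
move=> h_inj f g eq_fg; apply/ffunP=> i; apply/lfunP=> x.
apply: (at_ord0_inj (j := ordS i) h_inj).
by have := congr1 (fun f => rep_map f i x) eq_fg; rewrite /= !twistE.
Qed.

(** The first [n] steps from [ord0] never arrive at [ord0], so [h] enters only at the last step. *)
Lemma monodromy_twist h f x : monodromy (twist h f) x = h (monodromy f x).
Proof.
pose eta u : {i & V i} := Tagged V (at_ord0 h (tag u) (tagged u)).
have step_twist u : step (twist h f) u = eta (step f u).
  by rewrite /step twistE.
have iter_twist l : (l <= n)%N ->
    iter l (step (twist h f)) (Tagged V x) = iter l (step f) (Tagged V x).
  elim: l => // l IH lt_ln; rewrite !iterS IH ?(ltnW lt_ln) //.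
  rewrite step_twist -iterS.
  rewrite /eta at_ord0_id ?id_lfunE ?taggedK //.
  apply/eqP => /(congr1 (@nat_of_ord _)).
  rewrite tag_iter_step val_iter_ordS add0n.
  by rewrite modn_small.
apply: (@eq_from_Tagged _ V); rewrite monodromyE iterS iter_twist // step_twist.
by rewrite -iterS -monodromyE /eta /= at_ord00.
Qed.

(** * Invariant sections and fixed vectors of the monodromy *)

Local Notation section := {dffun forall i : 'I_n.+1, finvect_type (V i)}.

Definition invariant_section f (v : section) :=
  [forall i, (v i != 0) && (rep_map f i (v i) == v (ordS i))].

(** A section is determined by its value at [ord0], which the monodromy fixes; conversely, a nonzero
    fixed vector is propagated along the cycle. *)
Lemma card_invariant_section f :
  #|[set v | invariant_section f v]|
    = #|[set x : finvect_type (V ord0) | (x != 0) && (monodromy f x == x)]|.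
Proof.
have iterv v l i : invariant_section f v ->
    iter l (step f) (Tagged V (v i)) = Tagged V (v (iter l (@ordS _) i)).
  move/forallP=> vP; elim: l => //= l ->; rewrite /step /=.
  by have /andP[_ /eqP ->] := vP (iter l (@ordS _) i).
have inj0 : {in [set v | invariant_section f v] &,
    injective (fun v : section => v ord0)}.
  move=> v w; rewrite !inE => fv fw vw; apply/ffunP=> i.
  have -> : i = iter i (@ordS _) ord0.
    by apply: ord_inj; rewrite val_iter_ordS add0n modn_small.
  by apply: (@eq_from_Tagged _ V); rewrite -!iterv // vw.
rewrite -(card_in_imset inj0); congr #|pred_of_set _|; apply/setP=> x.
apply/imsetP/idP => [[v + ->]|].
  rewrite !inE => fv; have /forallP/(_ ord0)/andP[-> _] := fv.
  apply/eqP/(@eq_from_Tagged _ V); rewrite monodromyE iterv //.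
  by congr (Tagged V (v _)); apply: iter_ordS_n.
rewrite inE => /andP[x0 /eqP Mx].
pose u l := iter l (step f) (Tagged V x).
have tag_u (i : 'I_n.+1) : tag (u i) = i.
  rewrite tag_iter_step; apply: ord_inj.
  by rewrite val_iter_ordS add0n modn_small.
pose v : section := [ffun i => etagged (tag_u i)].
have vE i : Tagged V (v i) = u i by rewrite ffunE etaggedK.
exists v; last first.
  by apply: (@eq_from_Tagged _ V); rewrite vE.
rewrite inE; apply/forallP=> i; apply/andP; split.
  (* If the section vanished at [i], completing the turn from [i] would give [monodromy f x = 0]. *)
  apply: contraNneq x0 => vi0; rewrite -Mx -[_ == 0]/(is_zero (Tagged V _)).
  have -> : Tagged V (monodromy f x) = iter (n.+1 - i)%N (step f) (u i).
    by rewrite monodromyE /u -iterD subnK // ltnW.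
  by rewrite -vE iter_step0 // vi0 /is_zero.
apply/eqP/(@eq_from_Tagged _ V); rewrite vE -[LHS]/(step f (Tagged V (v i))) vE.
rewrite -[LHS]/(u i.+1) /=.
(* Only the arrow out of the last vertex wraps around; there the condition is [Mx]. *)
have := ltn_ord i; rewrite ltnS leq_eqVlt => /predU1P[->|lt_in].
  by rewrite modnn /u -iterS -monodromyE Mx.
by rewrite modn_small.
Qed.


(** * Cardinalities and the double count *)

Local Notation dimV i := (\dim {:V i}).

Lemma card_rep : #|rep| = (#|F| ^ (\sum_i dimV i * dimV (ordS i)))%N.
Proof.
rewrite card_dep_ffun foldrE big_map big_enum expn_sum.
by apply: eq_bigr => i _; rewrite card_finvect dim_Hom.
Qed.

Lemma card_section_neq0 :
  #|[set v : section | [forall i, v i != 0]]| = (\prod_i (#|F| ^ dimV i - 1))%N.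
Proof.
pose P i := [pred x : finvect_type (V i) | x != 0].
have -> : #|[set v : section | [forall i, v i != 0]]|
    = #|(family P : simpl_pred section)|.
  by apply: eq_card => v; rewrite inE.
rewrite card_family foldrE big_map big_enum; apply: eq_bigr => i _.
rewrite -card_finvect subn1 -(cardC1 (0 : finvect_type (V i))).
by apply: eq_card => x; rewrite !inE.
Qed.

Lemma card_preserving (v : section) : (forall i, v i != 0) ->
  (#|[set f : rep | [forall i, rep_map f i (v i) == v (ordS i)]]|
     * #|F| ^ (\sum_i dimV i) = #|F| ^ (\sum_i dimV i * dimV (ordS i)))%N.
Proof.
move=> v0; pose P i := [pred g : finvect_type 'Hom(V i, V (ordS i)) |
  (g : 'Hom(V i, V (ordS i))) (v i) == v (ordS i)].
have -> : #|[set f : rep | [forall i, rep_map f i (v i) == v (ordS i)]]|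
    = #|(family P : simpl_pred rep)|.
  by apply: eq_card => f; rewrite inE.
rewrite card_family foldrE big_map big_enum /=.
(* The condition on arrow [i] costs the dimension of its target, so the sum is shifted to match
   factor by factor. *)
have -> : (\sum_i dimV i = \sum_i dimV (ordS i))%N.
  exact: (reindex_inj (@ordS_inj n.+1)).
rewrite !expn_sum -big_split /=; apply: eq_bigr => i _.
apply: etrans (@card_Hom_at F (V i) (V (ordS i)) _ (v (ordS i)) (v0 i)).
congr (_ * _)%N.
by rewrite cardsE.
Qed.

(** Cleared of denominators and of the outer subtraction, so that it holds in the natural numbers.
    The second summand counts the complement through pairs of a representation and an invariant
    section. *)
Lemma card_nilpotent_reps :
  (#|nilpotent_reps V| * #|F| ^ (\sum_i dimV i)
    + #|F| ^ (\sum_i dimV i * dimV (ordS i)) * \prod_i (#|F| ^ dimV i - 1)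
   = #|F| ^ (\sum_i dimV i * dimV (ordS i)) * #|F| ^ (\sum_i dimV i))%N.
Proof.
rewrite -[in RHS]card_rep -[in RHS](cardsC (nilpotent_reps V)) mulnDl.
congr (_ + _)%N.
have -> : ~: nilpotent_reps V
    = [set f | [exists x in stable (monodromy f), x != 0]].
  apply/setP=> f; rewrite !inE -[RHS]negbK; congr (~~ _).
  by apply/asboolP/idP => /nilpotent_stable.
rewrite (card_stable_neq0 monodromy_twist twist_inj).
rewrite (eq_bigr (fun f =>
    \sum_(v in [set v | invariant_section f v]) 1)%N); last first.
  by move=> f _; rewrite sum1_card card_invariant_section.
rewrite (exchange_big_dep (fun v : section => [forall i, v i != 0])) /=;
  last first.
  move=> f v _; rewrite inE => /forallP fv; apply/forallP=> i.
  by have /andP[] := fv i.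
rewrite big_distrl -card_section_neq0 -sum1_card big_distrr /=.
apply: eq_big => [v|v]; rewrite inE // => /forallP v0.
rewrite muln1 -(card_preserving v0) -sum1_card; congr (_ * _)%N.
apply: eq_bigl => f; rewrite !inE; apply: eq_forallb => i.
by rewrite v0.
Qed.

End Monodromy.

Theorem theorem3p6 (k : nat) (hk : (2 <= k)%N)
    (F : finFieldType) (q : nat) (hq : #|F| = q)
    (beta : 'I_k -> nat) (V : 'I_k -> vectType F)
    (hV : forall i : 'I_k, \dim {:V i} = beta i) :
  (#|nilpotent_reps V|%:R : rat) =
    (q%:R : rat) ^ ((\sum_(i < k) beta i * beta (ordS i))%N%:Z
                    - (\sum_(i < k) beta i)%N%:Z)
    * (q%:R ^+ (\sum_(i < k) beta i)%N
       - \prod_(i < k) (q%:R ^+ beta i - 1)).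
Proof.
case: k hk => // n _ in beta V hV *.
have q_gt0 : (0 < q)%N by rewrite -hq; apply/card_gt0P; exists 0.
have q_neq0 : (q%:R : rat) != 0 by rewrite Num.Theory.pnatr_eq0 -lt0n.
have S_E : (\sum_i \dim {:V i} = \sum_i beta i)%N by apply: eq_bigr => i _.
have R_E : (\sum_i \dim {:V i} * \dim {:V (ordS i)}
    = \sum_i beta i * beta (ordS i))%N by apply: eq_bigr => i _; rewrite !hV.
have P_E : ((\prod_i (q ^ \dim {:V i} - 1))%N%:R : rat)
    = \prod_i (q%:R ^+ beta i - 1).
  rewrite natr_prod; apply: eq_bigr => i _.
  by rewrite natrB ?expn_gt0 ?q_gt0 // natrX hV.
have := congr1 (fun m => m%:R : rat) (card_nilpotent_reps V).
rewrite hq S_E R_E natrD !natrM P_E !natrX => eqN.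
have qS_neq0 := expf_neq0 (\sum_(i < n.+1) beta i)%N q_neq0.
(* Multiplying by [q] to the power of the sum of the [beta i] removes the negative exponent. *)
rewrite expfzDr // -exprnP -exprnN; apply: (mulIf qS_neq0).
by rewrite mulrAC mulfVK // mulrBr -eqN addrK.
Qed.
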